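(* For every fixed integer $k\ge 4$, the distance of every $n$-element permutation from being $k$-balanced is $\Omega(n^{k-1})$ as $n\to\infty$. That is, for every integer $k\ge4$ there exist $c>0$ and $n_0$ (depending only on $k$) such that for all $n\ge n_0$ and all $\pi\in\mathbb{S}_n$, $$\max_{\tau\in\mathbb{S}_k}\left|\#\tau(\pi)-\frac{\binom{n}{k}}{k!}\right|\ \ge\ c\,n^{k-1}.$$
   Context: $\mathbb{S}_n$ is the set of permutations of $[n]=\{1,\dots,n\}$. For $\pi\in\mathbb{S}_n$ and $\tau\in\mathbb{S}_k$ with $k\le n$, $\#\tau(\pi)$ denotes the number of sets $S=\{s_1<\dots<s_k\}\subseteq[n]$ such that for all $i,j\in[k]$: $\pi(s_i)<\pi(s_j)\iff\tau(i)<\tau(j)$. The distance of $\pi\in\mathbb{S}_n$ from being $k$-balanced is the $\ell_\infty$-distance between the vector $(\#\tau(\pi))_{\tau\in\mathbb{S}_k}$ (the $k$-profile of $\pi$) and the constant vector with all entries $\binom{n}{k}/k!$. *)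

(* Defs.v *)
From mathcomp Require Import all_boot all_order all_fingroup all_algebra.

Set Implicit Arguments.
Unset Strict Implicit.
Unset Printing Implicit Defensive.

Import Order.TTheory GRing.Theory Num.Theory.

Local Open Scope ring_scope.

(* [n] is represented by 'I_n = {0, ..., n-1}; only the relative order of the
   values matters for patterns, so the shift by one is immaterial. *)

(* s lists the elements of S increasingly: S = {s_1 < ... < s_k}. *)
Definition increasing_listing (k n : nat) (s : {ffun 'I_k -> 'I_n})
    (S : {set 'I_n}) : bool :=
  [forall i : 'I_k, forall j : 'I_k, (i < j)%N ==> (s i < s j)%N]
  && (S == [set s i | i : 'I_k]).

Definition induces_pattern (k n : nat) (tau : 'S_k) (pi : 'S_n)
    (S : {set 'I_n}) : bool :=
  [exists s : {ffun 'I_k -> 'I_n},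
    increasing_listing s S &&
    [forall i : 'I_k, forall j : 'I_k,
      (pi (s i) < pi (s j))%N == (tau i < tau j)%N]].

Definition pattern_count (k n : nat) (tau : 'S_k) (pi : 'S_n) : nat :=
  #|[set S : {set 'I_n} | induces_pattern tau pi S]|.

Definition profile (R : realFieldType) (k n : nat) (pi : 'S_n) :
    {ffun 'S_k -> R} :=
  [ffun tau => (pattern_count tau pi)%:R].

Definition balanced_profile (R : realFieldType) (k n : nat) :
    {ffun 'S_k -> R} :=
  [ffun => 'C(n, k)%:R / k`!%:R].

(* The entries are nonnegative, so starting the maximum at 0 does not affect
   its value on a nonempty index type such as 'S_k. *)
Definition linf_dist (R : realFieldType) (T : finType) (u v : {ffun T -> R}) : R :=
  \big[Num.max/0]_(t : T) `|u t - v t|.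

Definition dist_balanced (R : realFieldType) (k n : nat) (pi : 'S_n) : R :=
  linf_dist (profile R k pi) (balanced_profile R k n).

(* Main.v *)
Require Import Defs.
From mathcomp Require Import all_boot all_order all_fingroup all_algebra.
From mathcomp Require Import ring lra zify.
Import Order.TTheory GRing.Theory Num.Theory.
Local Open Scope ring_scope.

Set Implicit Arguments.
Unset Strict Implicit.
Unset Printing Implicit Defensive.

(** The number of inversions of a random permutation has variance of order [n^3].
    A nearly balanced profile pins the number of inversions close to its mean, but
    also pins the square of that number close to its mean, which exceeds the square
    of the mean by the variance; the two are incompatible.

    Let [e i j] be [1] if the positions [i], [j] and the values [pi i], [pi j] are
    in the same order, [-1] if they are in opposite orders, [0] if [i = j], and let
    [T = \sum_i \sum_j e i j]. Suppose that the distance from being [k]-balanced is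
    below [c n^(k-1)]. Any statistic that sums a pattern function over [m]-tuples of
    distinct positions, with [m <= k], is a linear function of the [k]-profile
    ([corr_double_count]), and is therefore within [O(c n^(m-1))] of its mean over
    random permutations ([corr_concentrated]). With [m = 2] this yields
    [|T| = O(c n)], since [T] has mean zero.

    On the other hand [T ^+ 2] is itself a statistic of arity at most [4]
    ([sqr_corr_pair_sign]), which is where [4 <= k] enters. The disjoint pairs of
    pairs have mean zero and contribute [O(c n^3)]; equal pairs contribute a
    nonnegative amount; and each of the four ways for two pairs to share one index
    has mean [n ^_ 3 / 9] ([sum_corr_cherry_sign]), up to an error [O(c n^2)]. Hence
    [T ^+ 2] is at least of order [n^3], the variance of the inversion statistic,
    when [c] is small, contradicting [T ^+ 2 = O(c^2 n^2)]. *)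

(** * Standardization and listings *)

Lemma card_ord_ltn (k a : nat) : (a <= k)%N -> #|[set j : 'I_k | (j < a)%N]| = a.
Proof.
move=> ak; have -> : [set j : 'I_k | (j < a)%N] = [set widen_ord ak i | i : 'I_a].
  apply/setP=> j; rewrite inE; apply/idP/imsetP => [ja|[i _ ->]]; last exact: (ltn_ord i).
  by exists (Ordinal ja) => //; apply: val_inj.
rewrite card_imset ?cardsT ?card_ord // => i j /(congr1 val) /= ?.
exact: val_inj.
Qed.

(** A permutation is recovered from the comparisons between its values: each
    value is the number of values below it. *)
Lemma perm_rankE (k : nat) (t : 'S_k) (i : 'I_k) :
  t i = #|[set j | (t j < t i)%N]| :> nat.
Proof.
rewrite -[LHS](card_ord_ltn (ltnW (ltn_ord (t i)))).
rewrite -[RHS](card_imset _ (@perm_inj _ t)); apply: eq_card => j.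
rewrite inE; apply/idP/imsetP => [ji|[l + ->]]; last by rewrite inE.
by exists ((t^-1)%g j); rewrite ?inE permKV.
Qed.

Lemma perm_order_inj (k : nat) (t u : 'S_k) :
  (forall i j, (t i < t j)%N = (u i < u j)%N) -> t = u.
Proof.
move=> tu; apply/permP=> i; apply: val_inj => /=.
rewrite [LHS]perm_rankE [RHS]perm_rankE.
by apply: eq_card => j; rewrite !inE tu.
Qed.

Lemma standardization (k : nat) (v : 'I_k -> nat) : injective v ->
  exists t : 'S_k, forall i j, (t i < t j)%N = (v i < v j)%N.
Proof.
move=> v_inj; pose r i := #|[set j | (v j < v i)%N]|.
have r_lt i j : (v i < v j)%N -> (r i < r j)%N.
  move=> ij; apply/proper_card/properP; split.
    by apply/subsetP=> l; rewrite !inE => /ltn_trans; apply.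
  by exists i; rewrite !inE ?ltnn.
have r_mono i j : (r i < r j)%N = (v i < v j)%N.
  apply/idP/idP; last exact: r_lt.
  apply: contraTT; rewrite -!leqNgt leq_eqVlt => /orP[/eqP/v_inj ->//|/r_lt/ltnW //].
have r_bnd i : (r i < k)%N.
  rewrite -[X in (_ < X)%N]card_ord -cardsT; apply/proper_card/properP.
  by split; [apply/subsetP=> j; rewrite !inE | exists i; rewrite !inE ?ltnn].
pose o i := Ordinal (r_bnd i).
have o_inj : injective o.
  move=> i j /(congr1 val) /= rij; apply: v_inj.
  by case: (ltngtP (v i) (v j)) => // /r_lt; rewrite rij ltnn.
by exists (perm o_inj) => i j; rewrite !permE /= r_mono.
Qed.

Section Listing.
Variables (k n : nat) (s : {ffun 'I_k -> 'I_n}) (S : {set 'I_n}).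
Hypothesis sS : increasing_listing s S.

Lemma listing_ltn i j : (s i < s j)%N = (i < j)%N.
Proof.
have s_lt (a b : 'I_k) : (a < b)%N -> (s a < s b)%N.
  by case/andP: sS => /forallP /(_ a) /forallP /(_ b) /implyP.
case: (ltngtP i j) => [/s_lt //|/s_lt/ltnW|/val_inj ->]; last by rewrite ltnn.
by rewrite leqNgt => /negbTE.
Qed.

Lemma listing_inj : injective s.
Proof.
move=> i j sij; apply: val_inj.
by case: (ltngtP i j) => //; rewrite -listing_ltn sij ltnn.
Qed.

Lemma listing_imset : S = [set s i | i : 'I_k].
Proof. by case/andP: sS => _ /eqP. Qed.

Lemma card_listing : #|S| = k.
Proof. by rewrite listing_imset (card_imset _ listing_inj) card_ord. Qed.

End Listing.

Lemma exists_listing (k n : nat) (S : {set 'I_n}) : #|S| = k ->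
  exists s : {ffun 'I_k -> 'I_n}, increasing_listing s S.
Proof.
move=> Sk; have bnd (i : 'I_k) : (i < #|S|)%N by rewrite Sk.
exists [ffun i => enum_val (Ordinal (bnd i))]; apply/andP; split.
  apply/forallP=> i; apply/forallP=> j; apply/implyP=> ij; rewrite !ffunE.
  have x0 := enum_val (Ordinal (bnd i)).
  rewrite !(enum_val_nth x0) /= -!(nth_map x0 0%N val) -?cardE //.
  have srt : sorted ltn (map val (enum S)).
    apply: (subseq_sorted ltn_trans _ (iota_ltn_sorted 0 n)).
    by rewrite -val_enum_ord map_subseq // enumT; apply: filter_subseq.
  by rewrite (sorted_ltn_nth ltn_trans) // inE size_map -cardE.
apply/eqP/setP=> x; apply/idP/imsetP=> [xS|[i _ ->]]; last by rewrite ffunE enum_valP.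
have rk : (enum_rank_in xS x < k)%N by rewrite -[X in (_ < X)%N]Sk.
exists (Ordinal rk) => //; rewrite ffunE -[LHS](enum_rankK_in xS xS).
by congr enum_val; apply: val_inj.
Qed.

Lemma induces_patternP (k n : nat) (tau : 'S_k) (pi : 'S_n) (S : {set 'I_n}) :
  reflect (exists2 s : {ffun 'I_k -> 'I_n}, increasing_listing s S &
             forall i j, (pi (s i) < pi (s j))%N = (tau i < tau j)%N)
    (induces_pattern tau pi S).
Proof.
apply: (iffP existsP) => [[s /andP[sS /forallP h]]|[s sS h]]; exists s => //.
  by move=> i j; exact: (eqP (forallP (h i) j)).
by rewrite sS; apply/forallP=> i; apply/forallP=> j; apply/eqP.
Qed.

Lemma listing_uniq (k n : nat) (s t : {ffun 'I_k -> 'I_n}) (S : {set 'I_n}) :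
  increasing_listing s S -> increasing_listing t S -> s = t.
Proof.
move=> sS tS; apply/ffunP=> i.
have [p ps] : exists p : 'S_k, forall j, s j = t (p j).
  have st j : exists l, s j == t l.
    have : s j \in S by rewrite (listing_imset sS) imset_f.
    by rewrite (listing_imset tS) => /imsetP[l _ ->]; exists l.
  have fE j : s j = t (xchoose (st j)) by apply/eqP/(xchooseP (st j)).
  have f_inj : injective (fun j => xchoose (st j)).
    by move=> a b ab; apply: (listing_inj sS); rewrite !fE ab.
  by exists (perm f_inj) => j; rewrite permE.
suff -> : s i = t ((1%g : 'S_k) i) by rewrite perm1.
rewrite ps; congr (t (fun_of_perm _ _)); apply: perm_order_inj => a b.
by rewrite !perm1 -[LHS](listing_ltn tS) -!ps (listing_ltn sS).
Qed.

(** Each [k]-subset of positions induces exactly one pattern: it has one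
    increasing listing, and the values along it have one standardization. *)
Lemma sum_by_pattern (V : nmodType) (k n : nat) (pi : 'S_n) (G : {set 'I_n} -> V) :
  \sum_(S : {set 'I_n} | #|S| == k) G S =
  \sum_(tau : 'S_k) \sum_(S | induces_pattern tau pi S) G S.
Proof.
rewrite (exchange_big_dep predT) //= [LHS]big_mkcond; apply: eq_bigr => S _.
case: eqP => Sk; last first.
  rewrite big_pred0 // => tau; apply/negbTE/induces_patternP => -[s sS _].
  exact/Sk/(card_listing sS).
have [s sS] := exists_listing Sk.
have pis_inj : injective (fun i => pi (s i) : nat).
  by move=> i j /val_inj/perm_inj/(listing_inj sS).
have [t tE] := standardization pis_inj.
rewrite (big_pred1 t) // => tau; apply/induces_patternP/eqP => [[s' s'S h]|->].
  by apply: perm_order_inj => i j; rewrite tE -h (listing_uniq sS s'S).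
by exists s.
Qed.

(** Removing [A] turns the [k]-sets containing [A] into the [(k - #|A|)]-subsets
    of the complement of [A]. *)
Lemma card_supersets (n k : nat) (A : {set 'I_n}) : (#|A| <= k)%N ->
  #|[set S : {set 'I_n} | (#|S| == k) && (A \subset S)]| = 'C(n - #|A|, k - #|A|).
Proof.
move=> Ak.
have <- : #|~: A| = (n - #|A|)%N by rewrite cardsCs setCK card_ord.
rewrite -cards_draws.
rewrite -(card_in_imset (f := fun S => S :\: A)).
  apply: eq_card => B; rewrite [RHS]inE; apply/imsetP/andP.
    move=> [S]; rewrite inE => /andP[/eqP <- AS] ->.
    by rewrite subsetDr cardsDS.
  move=> [BA /eqP Bk]; exists (A :|: B).
    rewrite inE subsetUl andbT cardsU Bk.
    have -> : A :&: B = set0 by apply: disjoint_setI0; rewrite disjoint_sym disjoints_subset.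
    by rewrite cards0 subn0 subnKC.
  by rewrite setDUl setDv set0U; apply/esym/setDidPl; rewrite disjoints_subset.
move=> S S'; rewrite !inE => /andP[_ AS] /andP[_ AS'] SS'.
by rewrite -(setID S A) -(setID S' A) SS' (setIidPr AS) (setIidPr AS').
Qed.

(** * Correlations and double counting *)

(** Statistics take sequences of naturals so that one [f] applies to
    permutations of every size; invariance only looks at sequences of the
    relevant length [m], where the default of [nth] never matters. *)
Definition order_invariant (R : Type) (m : nat) (f : seq nat -> R) : Prop :=
  forall t u : seq nat, size t = m -> size u = m ->
    (forall i j, (i < m)%N -> (j < m)%N ->
       (nth 0%N t i < nth 0%N t j)%N = (nth 0%N u i < nth 0%N u j)%N) ->
  f t = f u.

Lemma order_invariant_map (R I : Type) (m : nat) (f : seq nat -> R)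
    (g h : I -> nat) (x : m.-tuple I) :
  order_invariant m f -> (forall i j, (g i < g j)%N = (h i < h j)%N) ->
  f (map g x) = f (map h x).
Proof.
move=> f_inv gh; apply: f_inv; rewrite ?size_map ?size_tuple // => i j im jm.
have [x0 _] : {x0 : I | true} by exists (tnth x (Ordinal im)).
by rewrite !(nth_map x0) ?size_tuple // gh.
Qed.

Section Correlation.
Variables (R : realFieldType) (m : nat) (f : seq nat -> R).

(** [f] is applied to the positions and to the values: for the sign of
    [x1 - x0], the product is [-1] exactly when [x0] and [x1] form an inversion. *)
Definition corr_term (n : nat) (pi : 'S_n) (x : seq 'I_n) : R :=
  f [seq nat_of_ord i | i <- x] * f [seq nat_of_ord (pi i) | i <- x].

Definition corr (n : nat) (pi : 'S_n) : R :=
  \sum_(x : m.-tuple 'I_n | uniq x) corr_term pi x.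

Hypothesis f_inv : order_invariant m f.

(** The increasing listing of [S] carries tuples of ['I_k] to tuples of [S],
    preserving the order of positions by monotonicity and the order of values
    because [S] induces [tau]. *)
Lemma corr_restrict (k n : nat) (tau : 'S_k) (pi : 'S_n) (S : {set 'I_n}) :
  (0 < k)%N -> induces_pattern tau pi S ->
  \sum_(x : m.-tuple 'I_n | uniq x && all (mem S) x) corr_term pi x = corr tau.
Proof.
move=> k_gt0 /induces_patternP[s sS s_pi]; have s_inj := listing_inj sS.
have SE : S =i codom s.
  by move=> x; rewrite (listing_imset sS); apply/imsetP/codomP => -[i]; exists i.
pose i0 := Ordinal k_gt0.
(* [i0] is only a default; [s'] is the inverse of [s] on [S]. *)
pose s' y := odflt i0 [pick i | s i == y].
have sK : cancel s s'.
  move=> i; rewrite /s'; case: pickP => [j /eqP/s_inj //|/(_ i)]; by rewrite eqxx.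
have s'K y : y \in S -> s (s' y) = y.
  by rewrite SE => /codomP[i ->]; rewrite sK.
rewrite [LHS](reindex_onto (map_tuple s) (map_tuple s')) /=; last first.
  move=> x /andP[_ /allP xS]; apply: val_inj => /=.
  by rewrite -map_comp -[RHS]map_id; apply/eq_in_map => y /xS /s'K.
apply: eq_big => [x|x _].
  rewrite map_inj_uniq //; have -> : all (mem S) (map s x).
    by apply/allP => _ /mapP[i _ ->]; rewrite /= SE codom_f.
  have -> : map_tuple s' (map_tuple s x) = x.
    by apply: val_inj => /=; rewrite mapK.
  by rewrite eqxx !andbT.
rewrite /corr_term -!map_comp; congr (_ * _); apply: order_invariant_map => //.
exact: (listing_ltn sS).
Qed.

(** This is why the [k]-profile controls statistics of lower arity: every
    tuple of [m] distinct positions lies in ['C(n - m, k - m)] sets of size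
    [k], and the total over one such set only depends on its pattern. *)
Lemma corr_double_count (k n : nat) (pi : 'S_n) : (0 < k)%N -> (m <= k)%N ->
  corr pi * 'C(n - m, k - m)%:R =
  \sum_(tau : 'S_k) (pattern_count tau pi)%:R * corr tau.
Proof.
move=> k_gt0 mk.
transitivity (\sum_(S : {set 'I_n} | #|S| == k)
  \sum_(x : m.-tuple 'I_n | uniq x && all (mem S) x) corr_term pi x); last first.
  rewrite (sum_by_pattern _ pi); apply: eq_bigr => tau _.
  rewrite (eq_bigr (fun=> corr tau)); last by move=> S /(corr_restrict k_gt0).
  by rewrite sumr_const mulr_natl /pattern_count cardsE.
rewrite mulr_suml (exchange_big_dep (fun x : m.-tuple 'I_n => uniq x)) /=;
  last by move=> S x _ /andP[].
apply: eq_bigr => x x_uniq; rewrite sumr_const mulr_natr; congr (_ *+ _).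
have xm : #|[set i in x]| = m by rewrite cardsE (card_uniqP x_uniq) size_tuple.
rewrite -{1 2}xm -card_supersets ?xm // cardsE; apply: eq_card => S.
rewrite !unfold_in x_uniq; congr (_ && _).
by apply/subsetP/allP => h i; [move=> ?; apply: h; rewrite inE | rewrite inE; apply: h].
Qed.

End Correlation.

(** * Balanced profiles force correlations to their mean *)

(** Both sides count the [k]-subsets of an [n]-set together with [m] of
    their elements, distinct and listed in order. *)
Lemma bin_mul_ffact (n k m : nat) : (m <= k <= n)%N ->
  ('C(n, k) * k ^_ m = n ^_ m * 'C(n - m, k - m))%N.
Proof.
case/andP=> mk kn; have mn := leq_trans mk kn.
apply/eqP; rewrite -(eqn_pmul2r (fact_gt0 (k - m))) -(eqn_pmul2r (fact_gt0 (n - k))).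
rewrite -(mulnA 'C(n, k)) (ffact_fact mk) -(mulnA 'C(n, k)) (bin_fact kn).
have nk : (n - k = n - m - (k - m))%N by lia.
by rewrite nk -!mulnA bin_fact ?leq_sub2r // ffact_fact.
Qed.

(** The falling factorial [(n - m) ^_ (k - m)] has [k - m] factors, all at least
    [n - k], hence at least [n / 2]. *)
Lemma exp_le_bin (n k m : nat) : (m <= k)%N -> (2 * k <= n)%N ->
  (n ^ (k - m) <= 2 ^ k * k`! * 'C(n - m, k - m))%N.
Proof.
move=> mk kn.
have low : ((n - k) ^ (k - m) <= (n - m) ^_ (k - m))%N.
  rewrite ffact_prod -[X in (_ ^ X)%N]card_ord -prod_nat_const.
  by apply: leq_prod => i _; have := ltn_ord i; lia.
have fact_le : ((k - m)`! <= k`!)%N by rewrite leq_fact // leq_subr.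
have two_le : (2 ^ (k - m) <= 2 ^ k)%N by rewrite leq_exp2l // leq_subr.
apply: leq_trans (_ : (2 * (n - k)) ^ (k - m) <= _)%N.
  by have [->//|pos] := posnP (k - m)%N; rewrite leq_exp2r //; lia.
rewrite expnMn -mulnA; apply: leq_mul => //; apply: leq_trans low _.
by rewrite -bin_ffact mulnC leq_mul2r fact_le orbT.
Qed.

Section Deviation.
Variables (R : realFieldType) (m : nat) (f : seq nat -> R).
Hypothesis f_inv : order_invariant m f.

(** [mu] is the average over ['S_k] of the correlation per injective tuple; for
    an exactly balanced profile the double count would give [mu * n ^_ m]. *)
Lemma corr_sub_mean (k n : nat) (pi : 'S_n) (mu : R) :
  (0 < m <= k)%N -> (k <= n)%N ->
  \sum_(tau : 'S_k) corr m f tau = mu * (k ^_ m)%:R * (k`!)%:R ->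
  (corr m f pi - mu * (n ^_ m)%:R) * 'C(n - m, k - m)%:R =
  \sum_(tau : 'S_k) ((pattern_count tau pi)%:R - 'C(n, k)%:R / k`!%:R) * corr m f tau.
Proof.
move=> /andP[m_gt0 mk] kn mean.
have fact_neq0 : k`!%:R != 0 :> R by rewrite pnatr_eq0 -lt0n fact_gt0.
under [RHS]eq_bigr do rewrite mulrBl.
rewrite sumrB -mulr_sumr mean -(corr_double_count f_inv) // ?(leq_trans m_gt0) // mulrBl.
congr (_ - _); rewrite -[LHS]mulrA -natrM -bin_mul_ffact ?mk // natrM.
by field.
Qed.

(** The profile error [c n^(k-1)] is divided by ['C(n - m, k - m)], of order
    [n^(k-m)], leaving [c n^(m-1)]: one power of [n] below the trivial bound,
    whatever [k] is. *)
Lemma corr_concentrated (k : nat) (mu : R) :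
  (0 < m <= k)%N ->
  \sum_(tau : 'S_k) corr m f tau = mu * (k ^_ m)%:R * (k`!)%:R ->
  exists2 M : R, 0 <= M & forall (n : nat) (pi : 'S_n) (c : R),
    (2 * k <= n)%N -> dist_balanced R k pi <= c * n%:R ^+ k.-1 ->
    `|corr m f pi - mu * (n ^_ m)%:R| <= M * c * n%:R ^+ m.-1.
Proof.
move=> mk mean; have [m_gt0 m_le_k] := andP mk.
pose L : R := \sum_(tau : 'S_k) `|corr m f tau|.
have L_ge0 : 0 <= L by apply: sumr_ge0.
exists (L * (2 ^ k * k`!)%:R) => [|n pi c kn dist_le]; first exact: mulr_ge0.
have n_gt0 : (0 < n)%N by lia.
have nX_gt0 : 0 < n%:R ^+ (k - m) :> R by rewrite exprn_gt0 // ltr0n.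
rewrite -(ler_pM2r nX_gt0).
have -> : L * (2 ^ k * k`!)%:R * c * n%:R ^+ m.-1 * n%:R ^+ (k - m) =
    (2 ^ k * k`!)%:R * (c * n%:R ^+ k.-1 * L).
  by rewrite -[in RHS](_ : (m.-1 + (k - m))%N = k.-1) ?exprD; [ring | lia].
apply: le_trans (_ : (2 ^ k * k`!)%:R * (`|corr m f pi - mu * (n ^_ m)%:R| *
    'C(n - m, k - m)%:R) <= _).
  rewrite [leRHS]mulrCA ler_wpM2l // -natrM -natrX ler_nat.
  exact: exp_le_bin.
rewrite ler_wpM2l // -[X in _ * X <= _](@ger0_norm R) // -normrM.
rewrite corr_sub_mean ?(leq_trans _ kn) //; last by lia.
apply: le_trans (ler_norm_sum _ _ _) _; rewrite mulr_sumr ler_sum // => tau _.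
rewrite normrM ler_wpM2r //; apply: le_trans dist_le.
have := @le_bigmax _ R _ 0 (fun t : 'S_k => `|profile R k pi t - balanced_profile R k n t|) tau.
by rewrite !ffunE.
Qed.

End Deviation.

(** * Means of the sign statistics *)

Section Means.
Variable R : realFieldType.

Lemma sum_corrE (m k : nat) (f : seq nat -> R) :
  \sum_(tau : 'S_k) corr m f tau =
  \sum_(x : m.-tuple 'I_k | uniq x) f [seq nat_of_ord i | i <- x] *
     \sum_(tau : 'S_k) f [seq nat_of_ord (tau i) | i <- x].
Proof.
by rewrite exchange_big /=; apply: eq_bigr => x _; rewrite mulr_sumr.
Qed.

(** Exchanging the images of the first two entries of a tuple is an involution
    of the symmetric group that reverses the sign of [f]. *)
Lemma sum_corr_alternating (m k : nat) (f : seq nat -> R) :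
  (forall a b t, f [:: a, b & t] = - f [:: b, a & t]) ->
  \sum_(tau : 'S_k) corr m.+2 f tau = 0.
Proof.
move=> f_alt; rewrite sum_corrE big1 // => -[[|a [|b t]] //= _ /andP[a_bt /andP[bt _]]].
set A := \sum_tau _; suff A0 : A = - A by rewrite (_ : A = 0) ?mulr0 //; lra.
rewrite [LHS](reindex_inj (mulgI (tperm a b))) -sumrN; apply: eq_bigr => tau _.
rewrite !permM tpermL tpermR f_alt; congr (- f [:: _, _ & _]).
apply/eq_in_map => c ct; rewrite permM tpermD //.
  by apply: contraNneq a_bt => ->; rewrite inE ct orbT.
by apply: contraNneq bt => ->.
Qed.

Definition order_sign (a b : nat) : R := (a < b)%N%:R - (b < a)%N%:R.

Lemma order_signC a b : order_sign a b = - order_sign b a.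
Proof. by rewrite /order_sign opprB. Qed.

Lemma order_signaa a : order_sign a a = 0.
Proof. by rewrite /order_sign subrr. Qed.

(** Products of signs along the edges of a graph: a single edge, two edges with
    a common vertex (a cherry), and two disjoint edges. *)
Definition pair_sign (t : seq nat) : R := order_sign (nth 0 t 0) (nth 0 t 1).
Definition cherry_sign (t : seq nat) : R :=
  order_sign (nth 0 t 0) (nth 0 t 1) * order_sign (nth 0 t 0) (nth 0 t 2).
Definition two_pair_sign (t : seq nat) : R :=
  order_sign (nth 0 t 0) (nth 0 t 1) * order_sign (nth 0 t 2) (nth 0 t 3).

Lemma pair_sign_inv : order_invariant 2 pair_sign.
Proof. by move=> t u _ _ tu; rewrite /pair_sign /order_sign !tu. Qed.
Lemma cherry_sign_inv : order_invariant 3 cherry_sign.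
Proof. by move=> t u _ _ tu; rewrite /cherry_sign /order_sign !tu. Qed.
Lemma two_pair_sign_inv : order_invariant 4 two_pair_sign.
Proof. by move=> t u _ _ tu; rewrite /two_pair_sign /order_sign !tu. Qed.

Lemma sum_corr_pair_sign k : \sum_(tau : 'S_k) corr 2 pair_sign tau = 0.
Proof. by apply: sum_corr_alternating => a b t; apply: order_signC. Qed.

Lemma sum_corr_two_pair_sign k : \sum_(tau : 'S_k) corr 4 two_pair_sign tau = 0.
Proof.
by apply: sum_corr_alternating => a b t; rewrite /two_pair_sign /= order_signC mulNr.
Qed.

(** A product of two signs at a common vertex is [1] when that vertex is the
    minimum or the maximum of the three, and [-1] when it is the middle one. *)
Lemma sign_cycle (a b c : nat) : a != b -> a != c -> b != c ->
  order_sign a b * order_sign a c + order_sign b a * order_sign b c +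
  order_sign c b * order_sign c a = 1.
Proof.
rewrite /order_sign => ab ac bc.
case: (ltngtP a b) ab => // ab _; case: (ltngtP a c) ac => // ac _;
  case: (ltngtP b c) bc => // bc _; try lia; rewrite /=; lra.
Qed.

(** By symmetry under transpositions the sum is the same for the three choices
    of the central vertex, and the three integrands add up to [1]. *)
Lemma sum_perm_cherry_sign (k : nat) (a b c : 'I_k) : uniq [:: a; b; c] ->
  \sum_(tau : 'S_k) cherry_sign [seq nat_of_ord (tau i) | i <- [:: a; b; c]] = k`!%:R / 3.
Proof.
rewrite /= !inE negb_or => /andP[/andP[ab ac] /andP[bc _]].
set A := \sum_tau _.
pose e (tau : 'S_k) i j := order_sign (tau i) (tau j).
have AE : A = \sum_tau e tau a b * e tau a c by [].
have Ab : A = \sum_tau e tau b a * e tau b c.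
  rewrite AE (reindex_inj (mulgI (tperm a b))); apply: eq_bigr => tau _.
  by rewrite /e !permM tpermL tpermR tpermD // eq_sym.
have Ac : A = \sum_tau e tau c b * e tau c a.
  rewrite AE (reindex_inj (mulgI (tperm a c))); apply: eq_bigr => tau _.
  by rewrite /e !permM tpermL tpermR tpermD // eq_sym.
have : A + A + A = k`!%:R.
  rewrite {1}AE {1}Ab Ac -!big_split /=.
  rewrite (eq_bigr (fun=> 1)) => [|tau _]; last first.
    by apply: sign_cycle; rewrite (inj_eq val_inj) (inj_eq perm_inj).
  by rewrite sumr_const card_Sn.
lra.
Qed.

(** One factor [1/3] comes from the values, by the sum over permutations for a
    fixed tuple, and another from the positions: averaging over tuples
    commutes with relabelling them by a permutation. *)
Lemma sum_corr_cherry_sign k :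
  \sum_(tau : 'S_k) corr 3 cherry_sign tau = 9^-1 * (k ^_ 3)%:R * (k`!)%:R.
Proof.
pose W : R := \sum_(x : 3.-tuple 'I_k | uniq x) cherry_sign [seq nat_of_ord i | i <- x].
have inner (x : 3.-tuple 'I_k) : uniq x ->
    \sum_(tau : 'S_k) cherry_sign [seq nat_of_ord (tau i) | i <- x] = k`!%:R / 3.
  by case: x => -[|a [|b [|c [|]]]] //= _; apply: sum_perm_cherry_sign.
have totW : k`!%:R * W = (k ^_ 3)%:R * (k`!%:R / 3).
  transitivity (\sum_(tau : 'S_k) \sum_(x : 3.-tuple 'I_k | uniq x)
      cherry_sign [seq nat_of_ord (tau i) | i <- x]).
    rewrite -card_Sn mulr_natl -sumr_const; apply: eq_bigr => tau _.
    rewrite /W (reindex (map_tuple tau)) /=.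
      apply: eq_big => x; first by rewrite map_inj_uniq //; apply: perm_inj.
      by rewrite -map_comp.
    exists (map_tuple (tau^-1)%g) => x _; apply: val_inj => /=.
      by rewrite mapK //; apply: permK.
    by rewrite mapK //; apply: permKV.
  rewrite exchange_big /= (eq_bigr (fun=> k`!%:R / 3)) => [|x /inner //].
  rewrite sumr_const -[LHS]mulr_natl; congr (_%:R * _).
  have := card_uniq_tuples 3 (predT : {pred 'I_k}); rewrite card_ord => <-.
  by rewrite cardsE; apply: eq_card => x; rewrite !unfold_in /= all_predT.
rewrite sum_corrE (eq_bigr (fun x : 3.-tuple _ =>
  cherry_sign [seq nat_of_ord i | i <- x] * (k`!%:R / 3))) => [|x /inner -> //].
rewrite -mulr_suml -/W; lra.
Qed.

End Means.

(** * The square of the inversion statistic *)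

Section PairSums.
Variables (R : comPzRingType) (I : finType).

Lemma sum_tuple_cons (m : nat) (F : seq I -> R) :
  \sum_(x : m.+1.-tuple I) F x = \sum_a \sum_(x : m.-tuple I) F (a :: x).
Proof.
rewrite pair_bigA /=.
rewrite (reindex (fun p : I * m.-tuple I => [tuple of p.1 :: p.2])) //=.
exists (fun x => (thead x, [tuple of behead x])) => [[a x] _|x _] /=.
  by congr (_, _); apply: val_inj.
by rewrite [RHS]tuple_eta.
Qed.

Lemma sum_tuple0 (F : seq I -> R) : \sum_(x : 0.-tuple I) F x = F [::].
Proof. by rewrite (big_pred1 [tuple]) // => x; apply/esym/eqP/tuple0. Qed.

Lemma sum_avoid2 (g : I -> R) (i j : I) : i != j ->
  \sum_k ((k != i) && (k != j))%:R * g k = \sum_k g k - g i - g j.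
Proof.
move=> ij; under eq_bigr do rewrite mulr_natl mulrb.
rewrite -big_mkcond /= [in RHS](bigD1 i) //= [in RHS](bigD1 j) 1?eq_sym //=.
by rewrite (addrC (g i)) addrK (addrC (g j)) addrK.
Qed.

Variable e : I -> I -> R.
Hypotheses (e_diag : forall i, e i i = 0) (e_sym : forall i j, e i j = e j i).
Let d i := \sum_j e i j.

(** Inclusion-exclusion on the coincidences between the pairs [{i, j}] and
    [{k, l}]: there are four ways to share one index, each giving
    [\sum_i d i ^+ 2], and two ways to be equal, each of which has then been
    subtracted twice and is added back once. *)
Lemma sum_disjoint_pairs :
  \sum_i \sum_j \sum_k \sum_l (uniq [:: i; j; k; l])%:R * (e i j * e k l) =
  (\sum_i d i) ^+ 2 - 4 * (\sum_i d i ^+ 2) + 2 * (\sum_i \sum_j e i j ^+ 2).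
Proof.
set T := \sum_i d i.
have inner i j :
    \sum_k \sum_l (uniq [:: i; j; k; l])%:R * (e i j * e k l) =
    e i j * (T - 2 * d i - 2 * d j + 2 * e i j).
  have [->|ij] := eqVneq i j.
    by rewrite e_diag mul0r big1 // => k _; rewrite big1 // => l _; rewrite mul0r mulr0.
  transitivity (e i j * \sum_k ((k != i) && (k != j))%:R *
      \sum_l ((l != i) && (l != j))%:R * e k l).
    rewrite mulr_sumr; apply: eq_bigr => k _; rewrite !mulr_sumr; apply: eq_bigr => l _.
    have [->|kl] := eqVneq k l; first by rewrite e_diag !mulr0.
    rewrite /= !inE !negb_or ij kl !andbT (eq_sym i k) (eq_sym i l) (eq_sym j k) (eq_sym j l).
    by case: (k == i); case: (k == j); case: (l == i); case: (l == j); rewrite /=; ring.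
  under eq_bigr do rewrite sum_avoid2 //.
  rewrite sum_avoid2 // !sumrB !e_diag (e_sym j i).
  have col a : \sum_k e k a = d a by apply: eq_bigr => k _.
  rewrite !col -/(d i) -/(d j); under eq_bigr do rewrite -/(d _).
  by rewrite -/T; ring.
under eq_bigr => i _ do under eq_bigr => j _ do rewrite inner.
have -> : T ^+ 2 = \sum_i \sum_j e i j * T.
  by rewrite expr2 {1}/T mulr_suml; apply: eq_bigr => i _; rewrite mulr_suml.
have sq_row : \sum_i d i ^+ 2 = \sum_i \sum_j e i j * d i.
  by apply: eq_bigr => i _; rewrite expr2 {1}/d mulr_suml.
have sq_col : \sum_i d i ^+ 2 = \sum_i \sum_j e i j * d j.
  rewrite sq_row exchange_big /=; apply: eq_bigr => i _; apply: eq_bigr => j _.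
  by rewrite e_sym.
have -> : 4 * (\sum_i d i ^+ 2) =
    2 * (\sum_i \sum_j e i j * d i) + 2 * (\sum_i \sum_j e i j * d j).
  by rewrite -sq_row -sq_col; ring.
clear inner sq_row sq_col; clearbody T d.
rewrite !mulr_sumr -!big_split -sumrB -big_split /=; apply: eq_bigr => i _.
rewrite !mulr_sumr -!big_split -sumrB -big_split /=; apply: eq_bigr => j _.
ring.
Qed.

Lemma sum_cherries :
  \sum_i \sum_j \sum_l (uniq [:: i; j; l])%:R * (e i j * e i l) =
  (\sum_i d i ^+ 2) - (\sum_i \sum_j e i j ^+ 2).
Proof.
rewrite -sumrB; apply: eq_bigr => i _.
rewrite expr2 {1}/d mulr_suml -sumrB; apply: eq_bigr => j _.
have [->|ij] := eqVneq i j.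
  by rewrite e_diag big1 => [|l _]; rewrite ?mul0r ?mulr0 //; ring.
transitivity (e i j * \sum_l ((l != i) && (l != j))%:R * e i l).
  rewrite mulr_sumr; apply: eq_bigr => l _.
  rewrite /= !inE !negb_or ij !andbT (eq_sym i l) (eq_sym j l) /=; ring.
by rewrite sum_avoid2 // e_diag -/(d i); ring.
Qed.

End PairSums.

Section Square.
Variable R : realFieldType.

Lemma corr_nested (m n : nat) (f : seq nat -> R) (pi : 'S_n) :
  corr m f pi = \sum_(x : m.-tuple 'I_n) (uniq x)%:R * corr_term f pi x.
Proof.
by rewrite /corr big_mkcond; apply: eq_bigr => x _; rewrite mulr_natl mulrb.
Qed.

(** Expanding the square according to how the two pairs overlap: disjoint
    pairs, four kinds of pairs sharing one index, and equal pairs, whose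
    contribution is nonnegative. *)
Lemma sqr_corr_pair_sign (n : nat) (pi : 'S_n) :
  corr 4 (@two_pair_sign R) pi + 4 * corr 3 (@cherry_sign R) pi <= corr 2 (@pair_sign R) pi ^+ 2.
Proof.
pose e (i j : 'I_n) : R := order_sign R i j * order_sign R (pi i) (pi j).
have e_diag i : e i i = 0 by rewrite /e !order_signaa mul0r.
have e_sym i j : e i j = e j i.
  by rewrite /e (order_signC R i) (order_signC R (pi i)) mulrNN.
have -> : corr 2 (@pair_sign R) pi = \sum_i \sum_j e i j.
  pose G x := (uniq x)%:R * corr_term (@pair_sign R) pi x.
  rewrite corr_nested (sum_tuple_cons _ G); apply: eq_bigr => i _.
  rewrite (sum_tuple_cons _ (fun x => G (i :: x))); apply: eq_bigr => j _.
  rewrite (sum_tuple0 (fun x => G [:: i, j & x])) /G /= inE andbT.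
  have [->|_] := eqVneq i j; last by rewrite mul1r.
  by rewrite e_diag mul0r.
have -> : corr 3 (@cherry_sign R) pi =
    \sum_i \sum_j \sum_l (uniq [:: i; j; l])%:R * (e i j * e i l).
  pose G x := (uniq x)%:R * corr_term (@cherry_sign R) pi x.
  rewrite corr_nested (sum_tuple_cons _ G); apply: eq_bigr => i _.
  rewrite (sum_tuple_cons _ (fun x => G (i :: x))); apply: eq_bigr => j _.
  rewrite (sum_tuple_cons _ (fun x => G [:: i, j & x])); apply: eq_bigr => l _.
  rewrite (sum_tuple0 (fun x => G [:: i, j, l & x])); congr (_ * _).
  by rewrite /corr_term /cherry_sign /e /=; ring.
have -> : corr 4 (@two_pair_sign R) pi =
    \sum_i \sum_j \sum_k \sum_l (uniq [:: i; j; k; l])%:R * (e i j * e k l).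
  pose G x := (uniq x)%:R * corr_term (@two_pair_sign R) pi x.
  rewrite corr_nested (sum_tuple_cons _ G); apply: eq_bigr => i _.
  rewrite (sum_tuple_cons _ (fun x => G (i :: x))); apply: eq_bigr => j _.
  rewrite (sum_tuple_cons _ (fun x => G [:: i, j & x])); apply: eq_bigr => k _.
  rewrite (sum_tuple_cons _ (fun x => G [:: i, j, k & x])); apply: eq_bigr => l _.
  rewrite (sum_tuple0 (fun x => G [:: i, j, k, l & x])); congr (_ * _).
  by rewrite /corr_term /two_pair_sign /e /=; ring.
rewrite sum_disjoint_pairs // sum_cherries //.
have : 0 <= \sum_i \sum_j e i j ^+ 2.
  by apply: sumr_ge0 => i _; apply: sumr_ge0 => j _; apply: sqr_ge0.
lra.
Qed.

End Square.

Lemma ffact3_ge (n : nat) : (4 <= n)%N -> (n ^ 3 <= 8 * n ^_ 3)%N.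
Proof.
case: n => [|[|[|[|n]]]] // _; rewrite !ffactSS ffactn0; nia.
Qed.

(** * The distance bound *)

Theorem theorem3 (R : realFieldType) (k : nat) (hk : (4 <= k)%N) :
  exists c : R, 0 < c /\
  exists n0 : nat, forall n : nat, (n0 <= n)%N -> forall pi : 'S_n,
    c * n%:R ^+ k.-1 <= dist_balanced R k pi.
Proof.
have mean0 m f : \sum_(tau : 'S_k) corr m f tau = 0 ->
    \sum_(tau : 'S_k) corr m f tau = 0 * (k ^_ m)%:R * (k`!)%:R :> R.
  by rewrite !mul0r.
have [|M2 M2_ge0 conc2] :=
  corr_concentrated (@pair_sign_inv R) _ (mean0 _ _ (sum_corr_pair_sign R k)); first by lia.
have [|M3 M3_ge0 conc3] :=
  corr_concentrated (@cherry_sign_inv R) _ (sum_corr_cherry_sign R k); first by lia.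
have [|M4 M4_ge0 conc4] :=
  corr_concentrated (@two_pair_sign_inv R) _ (mean0 _ _ (sum_corr_two_pair_sign R k)); first by lia.
(* If the distance is below [c n^(k-1)] then the square expansion, divided by
   [n^3], reads [1/18 <= c (M2^2 + 4 M3 + M4)], where [1/18 = 4 * 1/9 * 1/8] and
   [1/8] comes from [n^3 <= 8 * n ^_ 3]; the extra [1] in [B] makes it false. *)
pose B := M2 ^+ 2 + 4 * M3 + M4 + 1.
have B_ge1 : 1 <= B by have := sqr_ge0 M2; rewrite /B; lra.
have B_gt0 : 0 < B by lra.
exists (18 * B)^-1; split; first by rewrite invr_gt0; lra.
set c := (18 * B)^-1.
have cB : c * B = 18^-1 by rewrite /c; field; lra.
have c_gt0 : 0 < c by rewrite invr_gt0; lra.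
have c_le1 : c <= 1 by rewrite /c invf_le1; lra.
exists (2 * k)%N => n kn pi; rewrite leNgt; apply/negP => /ltW dist_le.
have := conc2 n pi c kn dist_le; have := conc3 n pi c kn dist_le.
have := conc4 n pi c kn dist_le; have := sqr_corr_pair_sign R pi.
rewrite !mul0r !subr0 /= expr1.
have n3 : n%:R ^+ 3 <= 8 * (n ^_ 3)%:R :> R.
  by rewrite -natrX -natrM ler_nat ffact3_ge //; lia.
have n_ge1 : 1 <= n%:R :> R by rewrite ler1n; lia.
have n2 : n%:R ^+ 2 <= n%:R ^+ 3 :> R by rewrite (exprS _ 2) ler_peMl // sqr_ge0.
move: (corr 2 _ _) (corr 3 _ _) (corr 4 _ _) => T P3 P4 sq.
rewrite !ler_norml => /andP[P4_ge _] /andP[P3_ge _] /andP[T_ge T_le].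
have N_gt0 : 0 < n%:R ^+ 3 :> R by rewrite exprn_gt0 //; lra.
have T_sq : T ^+ 2 <= M2 ^+ 2 * c * n%:R ^+ 3.
  have : T ^+ 2 <= (M2 * c * n%:R) ^+ 2 by nra.
  move/le_trans; apply; rewrite !exprMn.
  have sq_le : M2 ^+ 2 * c ^+ 2 <= M2 ^+ 2 * c.
    by rewrite ler_wpM2l ?sqr_ge0 // expr2 ger_pMr.
  by apply: ler_pM sq_le n2; rewrite ?sqr_ge0 // -exprMn sqr_ge0.
have P3_low : 72^-1 * n%:R ^+ 3 - M3 * c * n%:R ^+ 3 <= P3.
  have : M3 * c * n%:R ^+ 2 <= M3 * c * n%:R ^+ 3 by rewrite ler_wpM2l // mulr_ge0 // ltW.
  lra.
have : 18^-1 * n%:R ^+ 3 <= (c * B - c) * n%:R ^+ 3 by rewrite /B; lra.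
by rewrite ler_pM2r // cB; lra.
Qed.
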